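(* Let $H$ be a $d$-regular graph ($d\ge1$) on $N$ vertices with spectral radius $\rho(H)\le\rho$, and let $G$ be any graph with maximum degree $\Delta$. Then \[\mathrm{rel\text{-}IS}(G\otimes H)\ge \mathrm{rel\text{-}IS}(G)\ge\Big(1-\frac{\rho\Delta}{2d}\Big)\mathrm{rel\text{-}IS}(G\otimes H).\]
   Context: For a graph $G=(V,E)$, $\mathrm{IS}(G)$ is the size of a maximum independent set and $\mathrm{rel\text{-}IS}(G)=\mathrm{IS}(G)/|V|$. The Kronecker product $G\otimes H$ has vertex set $V(G)\times V(H)$ and edges $\{(u,i),(v,j)\}$ for $\{u,v\}\in E(G)$, $\{i,j\}\in E(H)$. For a graph $H$ on $N$ vertices with adjacency matrix $A_H$ whose eigenvalues are $\sigma_1\ge\dots\ge\sigma_N$, the spectral radius is $\rho(H)=\max_{p\perp\mathbf{1}}\frac{|p^TA_Hp|}{\|p\|^2}=\max(\sigma_2(A_H),|\sigma_N(A_H)|)$, where $\mathbf 1$ is the all-ones vector. *)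

(* Defs.v *)
From HB Require Import structures.
From mathcomp Require Import all_boot all_order all_algebra.
From mathcomp Require Import all_classical all_reals topology normedtype.
From mathcomp Require Import derive.

Set Implicit Arguments.
Unset Strict Implicit.
Unset Printing Implicit Defensive.

Import Order.TTheory GRing.Theory Num.Theory.
Import numFieldNormedType.Exports.

Local Open Scope classical_set_scope.
Local Open Scope ring_scope.

Record graph := Graph {
  vertex :> finType;
  adj : rel vertex;
  adj_sym : symmetric adj;
  adj_irr : irreflexive adj }.

Section Combinatorics.
Variable G : graph.

Definition neighbours (v : G) : {set G} := [set w | adj v w]%SET.
Definition degree (v : G) : nat := #|neighbours v|.
Definition max_degree : nat := \max_(v : G) degree v.
Definition regular (d : nat) : Prop := forall v : G, degree v = d.

Definition independent (A : {set G}) : bool :=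
  [forall u in A, forall v in A, ~~ adj u v].
Definition IS : nat := \max_(A : {set G} | independent A) #|A|.

End Combinatorics.

Definition rel_IS (R : realType) (G : graph) : R := (IS G)%:R / #|G|%:R.

Section Kronecker.
Variables G H : graph.

Definition kron_adj : rel (G * H)%type :=
  fun x y => adj x.1 y.1 && adj x.2 y.2.

Lemma kron_adj_sym : symmetric kron_adj.
Proof. by move=> x y; rewrite /kron_adj adj_sym [adj x.2 _]adj_sym. Qed.

Lemma kron_adj_irr : irreflexive kron_adj.
Proof. by move=> x; rewrite /kron_adj adj_irr. Qed.

Definition kronecker : graph := Graph kron_adj_sym kron_adj_irr.

End Kronecker.

Notation "G ⊗ H" := (kronecker G H) (at level 40, left associativity).

Section Spectral.
Variables (R : realType) (H : graph).

Definition adj_mx : 'M[R]_#|H| :=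
  \matrix_(i, j) (adj (enum_val i) (enum_val j))%:R.

Definition dot (p q : 'rV[R]_#|H|) : R := (p *m q^T) 0 0.

(* |p^T A_H p| / ||p||^2 with p a row vector and the Euclidean norm; the    *)
(* library norm on matrices is the sup norm.                               *)
Definition rayleigh (p : 'rV[R]_#|H|) : R :=
  `|dot (p *m adj_mx) p| / dot p p.

Definition rayleigh_set : set R :=
  [set rayleigh p | p in [set p | p != 0 /\ dot p (const_mx 1) = 0]].

(* A supremum of a nonempty set as soon as H has two vertices, and then a   *)
(* maximum, see spectral_radius_max.                                       *)
Definition spectral_radius : R := sup rayleigh_set.


Let dotE (p q : 'rV[R]_#|H|) : dot p q = \sum_i p 0 i * q 0 i.
Proof. by rewrite /dot mxE; apply: eq_bigr => i _; rewrite mxE. Qed.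

Let dotZl a (p q : 'rV[R]_#|H|) : dot (a *: p) q = a * dot p q.
Proof. by rewrite /dot -scalemxAl mxE. Qed.

Let dotZr a (p q : 'rV[R]_#|H|) : dot p (a *: q) = a * dot p q.
Proof. by rewrite /dot linearZ -scalemxAr mxE. Qed.

Let dot_neq0 (p : 'rV[R]_#|H|) : p != 0 -> dot p p != 0.
Proof.
apply: contra_neq; rewrite dotE => p0; apply/rowP => i; rewrite mxE.
have /psumr_eq0P : forall i, true -> 0 <= p 0 i * p 0 i.
  by move=> j _; rewrite -expr2 sqr_ge0.
by move=> /(_ p0 i isT)/eqP; rewrite mulf_eq0 orbb => /eqP.
Qed.

Let rayleighZ a (p : 'rV[R]_#|H|) : a != 0 -> rayleigh (a *: p) = rayleigh p.
Proof.
move=> a0; rewrite /rayleigh -scalemxAl !dotZl !dotZr !mulrA -expr2.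
by rewrite normrM [`|a ^+ 2|]ger0_norm ?sqr_ge0// -mulf_div divff ?mul1r ?sqrf_eq0.
Qed.

Let dot_continuous (f g : 'rV[R]_#|H| -> 'rV[R]_#|H|) :
  (forall i, continuous (fun p => f p 0 i)) ->
  (forall i, continuous (fun p => g p 0 i)) ->
  continuous (fun p => dot (f p) (g p)).
Proof.
move=> cf cg.
have -> : (fun p => dot (f p) (g p)) = (fun p => \sum_i f p 0 i * g p 0 i).
  by apply/funext => p; rewrite dotE.
apply: continuous_big => [|i _]; first exact: add_continuous.
by move=> p; exact: cvgM (cf i p) (cg i p).
Qed.

Let mulmx_coord_continuous i :
  continuous (fun p : 'rV[R]_#|H| => (p *m adj_mx) 0 i).
Proof.
have -> : (fun p : 'rV[R]_#|H| => (p *m adj_mx) 0 i) =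
    (fun p => \sum_j p 0 j * adj_mx j i).
  by apply/funext => p; rewrite mxE.
apply: continuous_big => [|j _]; first exact: add_continuous.
by move=> p; exact: cvgM (@coord_continuous _ _ _ 0 j p) (cvg_cst _).
Qed.

Let rayleigh_continuous (p : 'rV[R]_#|H|) :
  p != 0 -> {for p, continuous rayleigh}.
Proof.
move=> p0.
have cA : continuous (fun q : 'rV[R]_#|H| => dot (q *m adj_mx) q).
  apply: (dot_continuous (f := fun q => q *m adj_mx) (g := id)) => i.
    exact: mulmx_coord_continuous.
  exact: coord_continuous.
have cN : continuous (fun q : 'rV[R]_#|H| => dot q q).
  by apply: (dot_continuous (f := id) (g := id)) => i; exact: coord_continuous.
exact: cvgM (cvg_norm (cA p)) (cvgV (dot_neq0 p0) (cN p)).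
Qed.

Let rayleigh_set_neq0 : (1 < #|H|)%N -> rayleigh_set !=set0.
Proof.
move=> H1; pose i : 'I_#|H| := Ordinal (ltnW H1); pose j := Ordinal H1.
pose p : 'rV[R]_#|H| := delta_mx 0 i - delta_mx 0 j.
exists (rayleigh p), p => //; split.
  apply/eqP => /rowP/(_ i); rewrite !mxE !eqxx /= => /eqP.
  by rewrite subr0 oner_eq0.
have delta1 k : dot (delta_mx 0 k) (const_mx 1) = 1.
  by rewrite /dot -rowE !mxE.
by rewrite /dot mulmxBl mxE [X in _ + X]mxE -!/(dot _ _) !delta1 subrr.
Qed.

Lemma spectral_radius_max : (1 < #|H|)%N ->
  rayleigh_set spectral_radius /\ ubound rayleigh_set spectral_radius.
Proof.
move=> H1.
pose S : set 'rV[R]_#|H| := [set p | `|p| = 1 /\ dot p (const_mx 1) = 0].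
have S_neq0 p : S p -> p != 0.
  by move=> [p1 _]; rewrite -normr_eq0 p1 oner_eq0.
have to_S p : p != 0 -> dot p (const_mx 1) = 0 -> S (`|p|^-1 *: p).
  move=> p0 p1; split; last by rewrite dotZl p1 mulr0.
  by rewrite normrZ normfV normr_id mulVf// normr_eq0.
have S0 : S !=set0.
  by have [_ [p [p0 p1] _]] := rayleigh_set_neq0 H1; exists (`|p|^-1 *: p); exact: to_S.
have cS : compact S.
  apply: bounded_closed_compact.
    by exists 1; split => // x x1 p [p1 _] /=; rewrite p1 ltW.
  have -> : S = ((fun p => `|p|) @^-1` [set 1]) `&`
                ((fun p => dot p (const_mx 1)) @^-1` [set 0]) by [].
  apply: closedI; apply: preimage_closed; try exact: closed_eq.
    by move=> p _; exact: norm_continuous.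
  move=> p _; apply: (dot_continuous (f := id) (g := cst (const_mx 1))) => i.
    exact: coord_continuous.
  exact: (@cst_continuous _ _ (const_mx 1 0 i : R)).
have [] := @compact_EVT_max _ _ rayleigh S S0 cS.
  apply: continuous_in_subspaceT => p /[!inE] Sp.
  exact/rayleigh_continuous/S_neq0.
move=> c /[!inE] Sc maxc.
have ubc : ubound rayleigh_set (rayleigh c).
  move=> _ [p [p0 p1] <-].
  rewrite -(@rayleighZ `|p|^-1 p) ?invr_eq0 ?normr_eq0//.
  by apply: maxc; rewrite inE; exact: to_S.
have inc : rayleigh_set (rayleigh c).
  by exists c => //; split; [exact: S_neq0|case: Sc].
suff -> : spectral_radius = rayleigh c by [].
apply/eqP; rewrite eq_le; apply/andP; split.
  by apply: ge_sup => //; exists (rayleigh c).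
by apply: ub_le_sup => //; exists (rayleigh c).
Qed.

End Spectral.

(* Main.v *)
Require Import Defs.
From mathcomp Require Import all_boot all_order all_algebra reals.
From mathcomp Require Import ring lra.
Import Order.TTheory GRing.Theory Num.Theory.
Local Open Scope ring_scope.

Set Implicit Arguments.
Unset Strict Implicit.
Unset Printing Implicit Defensive.

(** Let [I] be a maximum independent set of [G ⊗ H], [I_u] its fibre over a
    vertex [u] of [G] and [p u = |I_u| / N].  If [u] and [v] are adjacent in [G]
    then [H] has no edge between [I_u] and [I_v], and the expander mixing lemma
    gives [d p_u p_v <= rho (p_u + p_v) / 2].  Picking every vertex [u] of [G]
    independently with probability [p u] and deleting one endpoint of each
    surviving edge leaves an independent set of expected size at least
    [\sum_u p_u - \sum_(uv edge) p_u p_v >= (1 - rho Delta / 2d) |I| / N].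
    Since this lower bound is affine in each [p u], it is derandomized by moving
    the [p u] one at a time to [0] or [1]. *)

(** * The adjacency matrix as a bilinear form on functions on vertices *)

Section AdjacencyForm.
Variables (R : realType) (K : graph).
Implicit Types (f g h k p q : K -> R) (A B : {set K}).

Definition adj_form f g : R := \sum_x \sum_y (adj x y)%:R * (f x * g y).

(** This shape serves one-coordinate updates, polarization ([a = b = 1] or [-1]) and the centring of
    indicator functions. *)
Lemma adj_form_lin f g h k (a b : R) :
  adj_form (fun x => f x + a * g x) (fun x => h x + b * k x) =
  adj_form f h + b * adj_form f k + a * adj_form g h + a * b * adj_form g k.
Proof.
rewrite /adj_form !mulr_sumr -!big_split; apply: eq_bigr => x _ /=.
rewrite !mulr_sumr -!big_split; apply: eq_bigr => y _ /=; ring.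
Qed.

Lemma adj_formC f g : adj_form f g = adj_form g f.
Proof.
rewrite /adj_form exchange_big; apply: eq_bigr => x _; apply: eq_bigr => y _.
by rewrite [adj x y](@adj_sym K) [f y * _]mulrC.
Qed.

Lemma eq_adj_form f f' g g' :
  f =1 f' -> g =1 g' -> adj_form f g = adj_form f' g'.
Proof.
move=> ff gg; apply: eq_bigr => x _; apply: eq_bigr => y _.
by rewrite ff gg.
Qed.

Lemma degreeE (x : K) : (degree x)%:R = \sum_y (adj x y)%:R :> R.
Proof.
by rewrite /degree -sum1dep_card natr_sum big_mkcond; apply: eq_bigr => y _; case: adj.
Qed.

Lemma adj_form1r f : adj_form f (fun=> 1) = \sum_x (degree x)%:R * f x.
Proof.
apply: eq_bigr => x _; rewrite degreeE mulr_suml.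
by apply: eq_bigr => y _; rewrite mulr1.
Qed.

Lemma sum_mem (A : {set K}) : \sum_x (x \in A)%:R = #|A|%:R :> R.
Proof. by rewrite -sum1_card natr_sum [RHS]big_mkcond; apply: eq_bigr => x _; case: ifP. Qed.

(** * Rounding fractional vertex weights to an independent set *)

(* For 0-1 valued [p], twice the difference between the numbers of vertices and edges
   of the subgraph selected by [p]. *)
Definition vertex_edge p : R := 2 * \sum_u p u - adj_form p p.

Definition update p x (t : R) : K -> R := fun u => if u == x then t else p u.

(** The term quadratic in [t - p x] is [adj_form e e], which vanishes since there are no loops; so
    [vertex_edge] is affine in each coordinate. *)
Lemma vertex_edge_update p x t :
  vertex_edge (update p x t) =
  vertex_edge p + 2 * (t - p x) * (1 - \sum_v (adj x v)%:R * p v).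
Proof.
pose e u : R := (u == x)%:R.
have upd : update p x t =1 fun u => p u + (t - p x) * e u.
  by move=> u; rewrite /update /e; case: eqP => [->|_] /=; ring.
have sum_e f : \sum_u e u * f u = f x.
  rewrite (bigD1 x)//= big1 ?addr0 /e ?eqxx ?mul1r// => u ux.
  by rewrite (negPf ux) mul0r.
have eE f : adj_form e f = \sum_v (adj x v)%:R * f v.
  rewrite -(sum_e (fun u => \sum_v (adj u v)%:R * f v)).
  apply: eq_bigr => u _; rewrite mulr_sumr; apply: eq_bigr => v _; ring.
have ee : adj_form e e = 0.
  rewrite eE; under eq_bigr do rewrite mulrC.
  by rewrite sum_e adj_irr.
rewrite /vertex_edge (eq_adj_form upd upd) adj_form_lin ee.
rewrite (adj_formC p e) eE.
rewrite (eq_bigr _ (fun u _ => upd u)) big_split /= -mulr_sumr.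
have -> : \sum_u e u = 1 by rewrite -(sum_e (fun=> 1)); apply: eq_bigr => u _; rewrite mulr1.
ring.
Qed.

(** An affine function on [[0, 1]] is maximal at an endpoint, so the coordinates in [s] are rounded
    one by one. The equation [q u = (q u == 1)%:R] says that [q u] is 0 or 1. *)
Lemma vertex_edge_round p (s : seq K) : (forall u, 0 <= p u <= 1) ->
  exists q, [/\ forall u, 0 <= q u <= 1,
    forall u, u \in s -> q u = (q u == 1)%:R & vertex_edge p <= vertex_edge q].
Proof.
move=> p01; elim: s => [|x s [q [q01 qs le_pq]]]; first by exists p.
pose c := 1 - \sum_v (adj x v)%:R * q v.
(* The slope in coordinate [x] is [2 * c], so its sign selects the endpoint. *)
exists (update q x (0 < c)%R%:R); split.
- by move=> u; rewrite /update; case: ifP => // _; case: (0 < c); rewrite ?lexx ler01.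
- move=> u; rewrite inE /update; case: eqP => [_ _|_ /= /qs //].
  by case: (0 < c); rewrite ?eqxx // eq_sym oner_eq0.
apply: le_trans le_pq _; rewrite vertex_edge_update -/c; clearbody c.
have /andP[q0 q1] := q01 x.
rewrite lerDl -mulrA mulr_ge0//; case: ltP => c0 /=.
  by rewrite mulr_ge0 ?subr_ge0// ltW.
by rewrite mulr_le0// sub0r oppr_le0.
Qed.

Lemma vertex_edge_independent A : independent A ->
  vertex_edge (fun u => (u \in A)%:R) = 2 * #|A|%:R.
Proof.
move=> indA; rewrite /vertex_edge sum_mem [adj_form _ _]big1 ?subr0// => x _.
rewrite big1// => y _; have [xA|] := boolP (x \in A); last by rewrite mul0r mulr0.
have [yA|] := boolP (y \in A); last by rewrite !mulr0.
by rewrite (negPf (implyP (forallP (implyP (forallP indA x) xA) y) yA)) mul0r.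
Qed.

(* Deleting an endpoint of an edge inside [A] removes one vertex and at least
   one edge. *)
Lemma vertex_edge_set_le_IS A :
  vertex_edge (fun u => (u \in A)%:R) <= 2 * (IS K)%:R.
Proof.
have [n] := ubnP #|A|; elim: n A => // n IHn A /ltnSE leAn.
have [indA|] := boolP (independent A).
  by rewrite vertex_edge_independent// ler_pM2l// ler_nat (leq_bigmax_cond _ indA).
rewrite negb_forall => /existsP[x]; rewrite negb_imply => /andP[xA].
rewrite negb_forall => /existsP[y]; rewrite negb_imply negbK => /andP[yA xy].
apply: le_trans (IHn (A :\ x)%SET _); last first.
  by apply: leq_trans leAn; rewrite [in ltnRHS](cardsD1 x) xA.
have upd : (fun u => (u \in A :\ x)%SET%:R) =1 update (fun u => (u \in A)%:R) x 0.
  by move=> u; rewrite /update !inE; case: eqP.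
rewrite [leRHS]/vertex_edge (eq_adj_form upd upd) (eq_bigr _ (fun u _ => upd u)).
rewrite -/(vertex_edge _) vertex_edge_update lerDl xA sub0r mulrN1 mulNr -mulrN.
rewrite mulr_ge0// oppr_ge0 subr_le0 (bigD1 y)//= xy yA mulr1 lerDl.
by rewrite sumr_ge0// => v _; rewrite mulr_ge0.
Qed.

(** Rounding along [enum K] reaches every vertex and leaves the indicator of a set. *)
Lemma vertex_edge_le_IS p : (forall u, 0 <= p u <= 1) ->
  vertex_edge p <= 2 * (IS K)%:R.
Proof.
move=> /(@vertex_edge_round _ (enum K))[q [_ qs le_pq]].
apply: le_trans le_pq _.
have qE : q =1 fun u => (u \in [set v | q v == 1]%SET)%:R.
  by move=> u; rewrite inE -qs// mem_enum.
rewrite /vertex_edge (eq_adj_form qE qE) (eq_bigr _ (fun u _ => qE u)).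
exact: vertex_edge_set_le_IS.
Qed.

End AdjacencyForm.

(** * Expander mixing for two vertex sets with no edge between them *)

Section Mixing.
Variables (R : realType) (H : graph) (d : nat).
Hypotheses (d_gt0 : (0 < d)%N) (H_gt0 : (0 < #|H|)%N) (H_regular : regular H d).
Implicit Types (f g : H -> R) (A B : {set H}).

Let N : R := #|H|%:R.
Let rho := spectral_radius R H.

(** Guarantees that the supremum defining [spectral_radius] is attained. *)
Lemma regular_card_gt1 : (1 < #|H|)%N.
Proof.
have [x _] := card_gt0P H_gt0.
have : (0 < degree x)%N by rewrite H_regular.
case/card_gt0P => y; rewrite inE => xy.
apply/card_gt1P; exists x, y; split=> //.
by apply: contraTneq xy => ->; rewrite adj_irr.
Qed.

Lemma dot_enum_val f g :
  dot (\row_i f (enum_val i)) (\row_i g (enum_val i)) = \sum_x f x * g x.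
Proof.
rewrite /dot mxE (reindex _ (onW_bij _ (@enum_val_bij H))) /=.
by apply: eq_bigr => i _; rewrite !mxE.
Qed.

Lemma adj_mx_enum_val f :
  (\row_i f (enum_val i)) *m adj_mx R H =
  \row_i (\sum_x (adj x (enum_val i))%:R * f x).
Proof.
apply/rowP => i; rewrite !mxE (reindex _ (onW_bij _ (@enum_val_bij H))) /=.
by apply: eq_bigr => j _; rewrite !mxE mulrC.
Qed.

Lemma spectral_radius_ge0 : 0 <= rho.
Proof.
rewrite /rho; have [[p _ <-] _] := @spectral_radius_max R H regular_card_gt1.
rewrite /rayleigh divr_ge0// /dot mxE sumr_ge0// => i _.
by rewrite mxE -expr2 sqr_ge0.
Qed.

Lemma adj_form_le_spectral f : \sum_x f x = 0 ->
  `|adj_form f f| <= rho * \sum_x f x * f x.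
Proof.
move=> f0; pose p : 'rV[R]_#|H| := \row_i f (enum_val i).
have ff : dot p p = \sum_x f x * f x by rewrite dot_enum_val.
have fAf : dot (p *m adj_mx R H) p = adj_form f f.
  rewrite adj_mx_enum_val (dot_enum_val (fun y => \sum_x (adj x y)%:R * f x)).
  rewrite /adj_form exchange_big; apply: eq_bigr => y _; rewrite mulr_suml.
  by apply: eq_bigr => x _; rewrite mulrA.
(* The zero vector lies outside [rayleigh_set]; for it both sides are 0. *)
have [p0|p0] := eqVneq p 0.
  by rewrite -ff -fAf p0 !mul0mx /dot mul0mx !mxE normr0 mulr0.
have ff_gt0 : 0 < \sum_x f x * f x.
  have sq_ge0 x : true -> 0 <= f x * f x by rewrite -expr2 sqr_ge0.
  rewrite lt_neqAle sumr_ge0// andbT.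
  apply: contra_neq p0 => /esym/(psumr_eq0P sq_ge0) ff0; apply/rowP => i.
  by rewrite !mxE; apply/eqP; rewrite -[_ == 0]orbb -mulf_eq0 ff0.
rewrite -ler_pdivrMr// -ff -fAf.
have [_] := @spectral_radius_max R H regular_card_gt1; apply.
exists p => //; split=> //.
have -> : const_mx 1 = \row_i 1 :> 'rV[R]_#|H|.
  by apply/rowP => i; rewrite !mxE.
by rewrite (dot_enum_val f (fun=> 1)) -[RHS]f0; apply: eq_bigr => x _; rewrite mulr1.
Qed.

(** Combine the lower spectral bound at [f + g] with the upper one at [f - g]: the forms differ by
    [4 * adj_form f g], and the parallelogram law adds the squared norms. *)
Lemma adj_form_polarized f g : \sum_x f x = 0 -> \sum_x g x = 0 ->
  - (2 * adj_form f g) <= rho * (\sum_x f x * f x + \sum_x g x * g x).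
Proof.
move=> f0 g0.
have sum0 a : \sum_x (f x + a * g x) = 0.
  by rewrite big_split /= -mulr_sumr f0 g0 mulr0 addr0.
have sq a : \sum_x (f x + a * g x) * (f x + a * g x) =
    \sum_x f x * f x + 2 * a * \sum_x f x * g x + a ^+ 2 * \sum_x g x * g x.
  by rewrite !mulr_sumr -!big_split; apply: eq_bigr => x _ /=; ring.
have := adj_form_le_spectral (sum0 1).
have := adj_form_le_spectral (sum0 (-1)).
rewrite !sq !adj_form_lin (adj_formC g f) !ler_norml => /andP[_ le1] /andP[le2 _].
lra.
Qed.

Lemma mixing_no_edges A B : (forall x y, x \in A -> y \in B -> ~~ adj x y) ->
  2 * d%:R * (#|A|%:R / N) * (#|B|%:R / N) <= rho * (#|A|%:R / N + #|B|%:R / N).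
Proof.
move=> noAB.
have N_gt0 : 0 < N by rewrite ltr0n.
(* The indicator of [C] minus its density is orthogonal to constants; the factor 1 matches
   [adj_form_lin]. *)
pose f (C : {set H}) x : R := (x \in C)%:R + - (#|C|%:R / N) * 1.
have sum1 : \sum_(x : H) (1 : R) = N by rewrite sumr_const.
have f0 C : \sum_x f C x = 0.
  by rewrite big_split /= -mulr_sumr sum1 sum_mem mulNr divfK ?subrr// gt_eqF.
have ff C : \sum_x f C x * f C x <= #|C|%:R.
  have -> : \sum_x f C x * f C x = #|C|%:R - #|C|%:R ^+ 2 / N.
    transitivity (\sum_x ((x \in C)%:R + (- 2 * (#|C|%:R / N)) * (x \in C)%:R
        + (#|C|%:R / N) ^+ 2 * 1) : R).
      by apply: eq_bigr => x _; rewrite /f; case: (x \in C) => /=; ring.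
    rewrite !big_split /= -!mulr_sumr sum1 !sum_mem; field.
    by rewrite gt_eqF.
  by rewrite gerBl divr_ge0 ?sqr_ge0 ?ltW.
have form1 g : adj_form g (fun=> 1) = d%:R * \sum_x g x.
  by rewrite adj_form1r mulr_sumr; apply: eq_bigr => x _; rewrite H_regular.
have formAB : adj_form (fun x => (x \in A)%:R) (fun x => (x \in B)%:R) = 0 :> R.
  rewrite [LHS]big1// => x _; rewrite big1// => y _.
  have [xA|] := boolP (x \in A); last by rewrite mul0r mulr0.
  have [yB|] := boolP (y \in B); last by rewrite !mulr0.
  by rewrite (negPf (noAB _ _ xA yB)) mul0r.
have := adj_form_polarized (f0 A) (f0 B).
(* By regularity the three remaining terms of [adj_form (f A) (f B)] add up to
   [- d * #|A| * #|B| / N]. *)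
rewrite adj_form_lin formAB (adj_formC (fun=> 1) (fun x => (x \in B)%:R)).
rewrite !form1 !sum_mem sum1 => le_form.
have {}le_form := le_trans le_form
  (ler_wpM2l spectral_radius_ge0 (lerD (ff A) (ff B))).
rewrite -mulrDl [leRHS]mulrA ler_pdivlMr//; apply: le_trans le_form.
by rewrite le_eqVlt; apply/orP; left; apply/eqP; field; rewrite gt_eqF.
Qed.

End Mixing.

(** * Independent sets of the Kronecker product and their fibres *)

Section IndependentSets.
Variables G H : graph.

Lemma IS_witness (K : graph) : exists2 A : {set K}, independent A & #|A| = IS K.
Proof.
have i0 : independent (@finset.set0 K) by apply/forallP => x; rewrite inE.
have ind_gt0 : (0 < #|[pred A : {set K} | independent A]|)%N.
  by apply/card_gt0P; exists finset.set0.
by have [A indA ISA] := eq_bigmax_cond (fun A : {set K} => #|A|) ind_gt0; exists A.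
Qed.

(** If [A] is independent in [G], then [A] times all of [H] is independent in the product. *)
Lemma IS_kronecker_ge : (IS G * #|H| <= IS (G ⊗ H))%N.
Proof.
have [A indA <-] := IS_witness G.
rewrite -cardsT -cardsX; apply: (@leq_bigmax_cond _ _ (fun A : {set G ⊗ H} => #|A|)).
apply/forallP => x; apply/implyP; rewrite inE => /andP[xA _].
apply/forallP => y; apply/implyP; rewrite inE => /andP[yA _].
apply: contra (implyP (forallP (implyP (forallP indA x.1) xA) y.1) yA).
by case/andP.
Qed.

Definition fibre (I : {set G ⊗ H}) (u : G) : {set H} :=
  [set i | (u, i) \in I]%SET.

Lemma sum_card_fibre (I : {set G ⊗ H}) : (\sum_u #|fibre I u|)%N = #|I|.
Proof.
rewrite -sum1_card.
rewrite (eq_bigl (fun x => (true && ((x.1, x.2) \in I)))); last by case.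
rewrite -(pair_big_dep predT (fun u i => (u, i) \in I) (fun _ _ => 1%N)) /=.
by apply: eq_bigr => u _; rewrite -sum1dep_card.
Qed.

Lemma fibre_no_edges (I : {set G ⊗ H}) u v : independent I -> adj u v ->
  forall i j, i \in fibre I u -> j \in fibre I v -> ~~ adj i j.
Proof.
move=> indI uv i j; rewrite !inE => ui vj.
have := implyP (forallP (implyP (forallP indI (u, i)) ui) (v, j)) vj.
by rewrite /= /kron_adj uv.
Qed.

End IndependentSets.

Theorem lemma2 (R : realType) (G H : graph) (d N Delta : nat) (rho : R)
  (N_gt0 : (0 < N)%N) (H_card : #|H| = N)
  (d_ge1 : (1 <= d)%N) (H_regular : regular H d)
  (H_rho : spectral_radius R H <= rho)
  (G_Delta : max_degree G = Delta) :
  rel_IS R (G ⊗ H) >= rel_IS R G /\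
  rel_IS R G >= (1 - rho * Delta%:R / (2 * d%:R)) * rel_IS R (G ⊗ H).
Proof.
have H_gt0 : (0 < #|H|)%N by rewrite H_card.
have NR_gt0 : 0 < N%:R :> R by rewrite ltr0n.
have d_gt0 : 0 < d%:R :> R by rewrite ltr0n.
have rho_ge0 : 0 <= rho by apply: le_trans H_rho; exact: (spectral_radius_ge0 R d_ge1 H_gt0 H_regular).
(* Isolates the common factor [#|G|^-1], which is nonnegative, and 0 when [G] is empty. *)
have relE : rel_IS R (G ⊗ H) = (IS (G ⊗ H))%:R / N%:R / #|G|%:R.
  by rewrite /rel_IS card_prod H_card natrM invfM [_^-1 * _]mulrC mulrA.
rewrite relE /rel_IS; split.
  rewrite ler_wpM2r ?invr_ge0// ler_pdivlMr// -natrM ler_nat -H_card.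
  exact: IS_kronecker_ge.
rewrite mulrA ler_wpM2r ?invr_ge0//.
have [I indI <-] := IS_witness (G ⊗ H).
pose p u : R := #|fibre I u|%:R / N%:R.
have p_ge0 u : 0 <= p u by rewrite divr_ge0.
have p01 u : 0 <= p u <= 1.
  by rewrite p_ge0 ler_pdivrMr// mul1r ler_nat -H_card max_card.
have sump : \sum_u p u = #|I|%:R / N%:R.
  by rewrite -mulr_suml -natr_sum sum_card_fibre.
have sump_ge0 : 0 <= \sum_u p u by rewrite sumr_ge0.
have form_pp : d%:R * adj_form p p <= rho * Delta%:R * \sum_u p u.
  (* The mixing bound is summed over ordered adjacent pairs; by symmetry [p u + p v] contributes
     twice the sum of [p u]. *)
  have le_edge : 2 * d%:R * adj_form p p <= rho * (2 * adj_form p (fun=> 1)).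
    have -> : 2 * adj_form p (fun=> 1) =
        \sum_u \sum_v (adj u v)%:R * (p u + p v).
      rewrite mulr_natl mulr2n {2}adj_formC -big_split; apply: eq_bigr => u _.
      by rewrite -big_split; apply: eq_bigr => v _ /=; ring.
    rewrite !mulr_sumr; apply: ler_sum => u _; rewrite !mulr_sumr.
    apply: ler_sum => v _; have [uv|_] := boolP (adj u v); last by rewrite !mul0r !mulr0.
    rewrite !mul1r mulrA.
    have := mixing_no_edges R d_ge1 H_gt0 H_regular (fibre_no_edges indI uv).
    rewrite H_card => /le_trans; apply.
    by rewrite -!/(p _) ler_wpM2r// addr_ge0.
  have deg : adj_form p (fun=> 1) <= Delta%:R * \sum_u p u.
    rewrite adj_form1r mulr_sumr; apply: ler_sum => u _.
    by rewrite ler_wpM2r// ler_nat -G_Delta (leq_bigmax u).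
  have := ler_wpM2l rho_ge0 deg; rewrite !mulrA; lra.
(* Now [2 * s - adj_form p p <= 2 * IS G] with [s = #|I| / N]; inserting [form_pp] and halving gives
   the factor [1 - rho * Delta / (2 * d)]. *)
have := vertex_edge_le_IS p01; rewrite /vertex_edge -sump.
move: (\sum_u p u) form_pp => s form_pp le_IS.
have le_form : adj_form p p <= rho * Delta%:R / d%:R * s.
  by rewrite mulrAC ler_pdivlMr// mulrC.
rewrite invfM [2^-1 * _]mulrC mulrA; lra.
Qed.
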